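(* Let $n\in\mathbb N_0$, $q\in\mathbb C$ with $0<|q|<1$, $z\in\mathbb C\setminus\{0\}$ and $x=\frac12(z+z^{-1})\neq0$. Fix a fourth root $q^{1/4}$ of $q$ and let all powers $q^{j/4}$, $j\in\mathbb Z$, be powers of it. Then the continuous $q$-Hermite polynomial $H_n(x|q)$ satisfies $$H_n(x|q)=q^{-\frac n4}\,(-q^{\frac12};q^{\frac12})_n\;{}_3\phi_2\left(q^{-\frac n2},\,q^{\frac14}z,\,q^{\frac14}z^{-1};\ -q^{\frac12},\,0;\ q^{\frac12},q^{\frac12}\right),$$ and, provided the denominators below do not vanish (i.e. $(q^{\frac14}z,q^{\frac14}z^{-1};q^{\frac12})_n\ne0$), $$H_n(x|q)=(-1)^nq^{-\frac{n^2}4}\,(q^{\frac14}z,q^{\frac14}z^{-1};q^{\frac12})_n\;{}_2\phi_2\left(q^{-\frac n2},\,-q^{-\frac n2};\ q^{\frac14-\frac n2}z,\,q^{\frac14-\frac n2}z^{-1};\ q^{\frac12},-q^{\frac12}\right).$$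
   Context: $(a;q)_n=\prod_{j=0}^{n-1}(1-aq^j)$, $(a_1,\dots,a_k;q)_n=\prod_i(a_i;q)_n$, and $${}_r\phi_s(a_1,\dots,a_r;b_1,\dots,b_s;q,z)=\sum_{k\ge0}\frac{(a_1,\dots,a_r;q)_k}{(q,b_1,\dots,b_s;q)_k}\left((-1)^kq^{\binom k2}\right)^{1+s-r}z^k ,$$ where if a numerator parameter equals $q^{-n}$ ($q$ being the base of the series), $n\in\mathbb N_0$, the sum is over $0\le k\le n$. In the claim the base of the series is $q^{1/2}$. The continuous $q$-Hermite polynomials are defined, for $x=\frac12(z+z^{-1})$, by $H_n(x|q)=z^n\,{}_2\phi_0\left(q^{-n},0;-;q,q^n/z^2\right)$ (a ''$-$'' denotes an empty list of parameters). *)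

(* Defs.v *)
From HB Require Import structures.
From mathcomp Require Import all_boot all_order all_algebra.
From mathcomp Require Import complex ring.
From mathcomp Require Import all_classical all_reals all_analysis.

Set Implicit Arguments.
Unset Strict Implicit.
Unset Printing Implicit Defensive.

Import Order.TTheory GRing.Theory Num.Theory numFieldNormedType.Exports.

Local Open Scope ring_scope.

Section BasicHypergeometric.
Variable K : numFieldType.
Implicit Types (a q z : K) (aa bb : seq K).

Definition qpoch a q (n : nat) : K := \prod_(j < n) (1 - a * q ^+ j).

Definition qpochs aa q (n : nat) : K := \prod_(a <- aa) qpoch a q n.

(* The exponent 1 + s - r is an integer, negative in the 2phi0 case. *)
Definition qhyp_term aa bb q z (k : nat) : K :=
  qpochs aa q k / qpochs (q :: bb) q k
  * ((-1) ^+ k * q ^+ 'C(k, 2)) ^ ((size bb).+1%:Z - (size aa)%:Z)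
  * z ^+ k.

Definition terminates_at aa q : pred nat := fun n => q ^- n \in aa.

(* If several numerator parameters are of the form q^-n, the sum stops at the
   least such n; the numerators of all later terms vanish. *)
Definition qhyp aa bb q z : K :=
  if pselect (exists n, terminates_at aa q n) is left ex_n
  then \sum_(0 <= k < (ex_minn ex_n).+1) qhyp_term aa bb q z k
  else limn (series (qhyp_term aa bb q z)).

End BasicHypergeometric.

Section ContinuousQHermite.
Variable K : numClosedFieldType.
Implicit Types (q x z : K) (n : nat).

Definition qHermite_rep n q z : K :=
  z ^+ n * qhyp [:: q ^- n; 0] [::] q (q ^+ n / z ^+ 2).

(* Any z with x = (z + z^-1) / 2 may be chosen, by [cqHermiteE] below. *)
Definition cqHermite n q x : K :=
  qHermite_rep n q (xget 1 [set z | z != 0 /\ x = (z + z^-1) / 2]%classic).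

Lemma qpochS (a q : K) k : qpoch a q k.+1 = qpoch a q k * (1 - a * q ^+ k).
Proof. by rewrite /qpoch big_ord_recr. Qed.

Lemma qpoch_neq0 q k : 0 < `|q| < 1 -> qpoch q q k != 0.
Proof.
move=> /andP[q0 q1]; rewrite /qpoch; apply/prodf_neq0 => j _.
rewrite -exprS subr_eq0; apply: contraTneq q1 => /(congr1 Num.norm).
rewrite normr1 normrX => e; have: `|q| ^+ j.+1 = 1 by [].
by move/eqP; rewrite pexpr_eq1 // => /eqP ->; rewrite ltxx.
Qed.

Lemma qexp_inj q : 0 < `|q| < 1 -> injective (fun n => q ^- n).
Proof.
move=> /andP[q0 q1] m n /invr_inj /(congr1 Num.norm); rewrite !normrX.
exact: (ieexprIn q0 (negbT (lt_eqF q1))).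
Qed.

Lemma qpochNE q n k : 0 < `|q| < 1 -> (k <= n)%N ->
  qpoch (q ^- n) q k * qpoch q q (n - k)
  = (-1) ^+ k * q ^+ 'C(k, 2) * q ^- (n * k) * qpoch q q n.
Proof.
move=> hq; have q0 : q != 0 by case/andP: hq; rewrite normr_gt0.
elim: k => [|k IH] lkn.
  by rewrite subn0 muln0 /qpoch big_ord0 bin0n !expr0 invr1 !mul1r.
have := IH (ltnW lkn).
rewrite -{1}(subnSK lkn) !qpochS -exprS subnSK // => E.
have h1 : 1 - q ^+ (n - k) != 0.
  move: (qpoch_neq0 (n - k) hq); rewrite -(subnSK lkn) qpochS -exprS.
  by rewrite mulf_eq0 negb_or => /andP[].
apply: (mulIf h1).
have -> : qpoch (q ^- n) q k * (1 - q ^- n * q ^+ k) * qpoch q q (n - k.+1)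
    * (1 - q ^+ (n - k))
  = (1 - q ^- n * q ^+ k)
    * (qpoch (q ^- n) q k * (qpoch q q (n - k.+1) * (1 - q ^+ (n - k)))).
  by rewrite -!mulrA [RHS]mulrCA.
rewrite E.
have -> : 1 - q ^- n * q ^+ k = - (q ^- n * q ^+ k) * (1 - q ^+ (n - k)).
  rewrite mulrBr mulr1 mulNr -mulrA -exprD subnKC ?(ltnW lkn) //.
  by rewrite mulVf ?expf_neq0 // opprK addrC.
rewrite binS bin1 mulnS !exprD exprS.
have := expf_neq0 n q0; have := expf_neq0 (n * k) q0.
set A := q ^+ (n * k); set B := q ^+ n; move=> A0 B0.
by field; rewrite A0 B0.
Qed.

Lemma qHermite_repE q n z : 0 < `|q| < 1 -> z != 0 ->
  qHermite_rep n q z = \sum_(k < n.+1)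
    qpoch q q n / (qpoch q q k * qpoch q q (n - k)) * (z ^+ (n - k) / z ^+ k).
Proof.
move=> hq z0; have q0 : q != 0 by case/andP: hq; rewrite normr_gt0.
have qn0 m : q ^- m == 0 = false by rewrite invr_eq0 expf_eq0 (negbTE q0) andbF.
rewrite /qHermite_rep /qhyp; case: pselect => [ex_n|]; last first.
  by case; exists n; rewrite /terminates_at mem_head.
case: ex_minnP => m tm _.
have {tm} -> : m = n.
  move: tm; rewrite /terminates_at !inE qn0 orbF => /eqP; exact: qexp_inj.
rewrite big_mkord big_distrr /=; apply: eq_bigr => -[k /= lkn] _.
rewrite ltnS in lkn.
rewrite /qhyp_term /qpochs !big_cons !big_nil /= !mulr1.
have -> : qpoch 0 q k = 1.
  by rewrite /qpoch big1 // => j _; rewrite mul0r subr0.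
rewrite mulr1 (_ : 1%:Z - 2%:Z = -1) // exprN1.
have := qpochNE hq lkn; have := qpoch_neq0 k hq; have := qpoch_neq0 (n - k) hq.
set a := qpoch (q ^- n) q k; set b := qpoch q q k; set c := qpoch q q (n - k).
move=> c0 b0 E.
have -> : a = (-1) ^+ k * q ^+ 'C(k, 2) * q ^- (n * k) * qpoch q q n / c.
  by rewrite -E mulfK.
rewrite expr_div_n -!exprM (mulnC 2%N) muln2 -addnn exprD -{1}(subnK lkn) exprD.
have s0 : (-1) ^+ k != 0 :> K by rewrite expf_neq0 // oppr_eq0 oner_eq0.
have := expf_neq0 'C(k, 2) q0; have := expf_neq0 (n * k) q0.
have := expf_neq0 k z0; move: s0.
set A := q ^+ (n * k); set B := q ^+ _; set C := z ^+ k; set D := (-1) ^+ k.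
by move=> D0 C0 A0 B0; field; rewrite A0 B0 C0 D0 b0 c0.
Qed.

Lemma qHermite_repV q n z : 0 < `|q| < 1 -> z != 0 ->
  qHermite_rep n q z^-1 = qHermite_rep n q z.
Proof.
move=> hq z0; rewrite !qHermite_repE ?invr_eq0 //.
rewrite (reindex_inj rev_ord_inj) /=; apply: eq_bigr => -[k /= lkn] _.
rewrite subSS subKn // [_ * qpoch q q k]mulrC; congr (_ * _).
by rewrite !exprVn invrK mulrC.
Qed.

Lemma cqHermiteE q n z : 0 < `|q| < 1 -> z != 0 ->
  cqHermite n q ((z + z^-1) / 2) = qHermite_rep n q z.
Proof.
move=> hq z0; rewrite /cqHermite; case: xgetP => [y _ [y0 e]|/(_ z)]; last first.
  by case; split.
have {}e : (y - z) * (y * z - 1) = 0.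
  have {}e : z + z^-1 = y + y^-1.
    by apply: (mulIf _ e); rewrite invr_eq0 pnatr_eq0.
  have -> : (y - z) * (y * z - 1) = y * z * ((y + y^-1) - (z + z^-1)).
    by field; rewrite y0 z0.
  by rewrite e subrr mulr0.
move/eqP: e; rewrite mulf_eq0 !subr_eq0 => /orP[/eqP -> //|/eqP e].
by rewrite -(qHermite_repV n hq z0) -(mulfK z0 y) e mul1r.
Qed.

End ContinuousQHermite.

(* Main.v *)
Require Import Defs.
From HB Require Import structures.
From mathcomp Require Import all_boot all_order all_algebra.
From mathcomp Require Import complex ring zify.
From mathcomp Require Import all_classical all_reals all_analysis.

Import Order.TTheory GRing.Theory Num.Theory numFieldNormedType.Exports.

Local Open Scope ring_scope.

(** Put p = w^2, so that q = p^2, and let F_n be the 3phi2 of the first formula.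

    First formula.  H_n satisfies the three-term recurrence
      H_(n+1) = (z + 1/z) H_n - (1 - q^n) H_(n-1)
    ([qHermite_rep_rec]), and so does its claimed value w^-n (-p;p)_n F_n
    ([phi32_recurrence]); both are 1 at n = 0.  Since the coefficient 1 - q^n
    vanishes at n = 0, the recurrence also determines the value at n = 1 and
    no second initial value is involved ([rec2_uniq]).
    The recurrence for F_n comes from the factors wz and w/z: the products
    phi_k = (wz, w/z; p)_k obey
      phi_(k+1) = (1 - w p^k (z + 1/z) + p^(2k+1)) phi_k,
    which turns multiplication by z + 1/z into a shift of k.  What is left is an
    identity between coefficients, up to a telescoping sum
    ([phi32_contiguous]).  In both recurrences, b being the base, the factors
    (b^-m;b)_j that occur for m = n-1, n, n+1 are rational multiples of a single
    one ([qpoch_succ], [qpoch_pred]), so that the identities between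
    coefficients are rational identities in b^n and b^k.

    Second formula.  It is the first one summed backwards.  The reversal rule
    [qpoch_rev], applied to each shifted factorial of the 3phi2, carries the
    term of index n - k to the term of index k of the 2phi2
    ([phi32_reverse]). *)

Set Implicit Arguments.
Unset Strict Implicit.

(** * Shifted factorials *)

Lemma qpoch0 (K : numFieldType) (a q : K) : qpoch a q 0 = 1.
Proof. by rewrite /qpoch big_ord0. Qed.

Lemma qpoch_base0 (K : numFieldType) (q : K) k : qpoch 0 q k = 1.
Proof. by rewrite /qpoch big1 // => j _; rewrite mul0r subr0. Qed.

Lemma qpoch_recl (K : numFieldType) (a q : K) k :
  qpoch a q k.+1 = (1 - a) * qpoch (a * q) q k.
Proof.
rewrite /qpoch big_ord_recl expr0 mulr1; congr (_ * _).
by apply: eq_bigr => j _; rewrite /= -mulrA -exprS.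
Qed.

Lemma qpoch_small_neq0 (K : numFieldType) (a q : K) k :
  `|a| < 1 -> `|q| < 1 -> qpoch a q k != 0.
Proof.
move=> a1 q1; apply/prodf_neq0 => j _.
rewrite subr_eq0; apply: contraTneq a1 => /(congr1 Num.norm).
rewrite normr1 normrM normrX => e; apply/negP => a1.
have : `|a| * `|q| ^+ j < 1.
  by apply: le_lt_trans a1; rewrite ler_piMr // exprn_ile1 // ltW.
by rewrite -e ltxx.
Qed.

(** This is what makes a series with numerator parameter q^-m terminate. *)
Lemma qpoch_eq0 (K : numFieldType) (q : K) m k :
  q != 0 -> (m < k)%N -> qpoch (q ^- m) q k = 0.
Proof.
move=> q0 mk; rewrite /qpoch (bigD1 (Ordinal mk)) //=.
by rewrite mulVf ?expf_neq0 // subrr mul0r.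
Qed.

Lemma qpoch_succ (K : numFieldType) (q : K) n k : q != 0 ->
  qpoch (q ^- n.+1) q k.+1 = (1 - q ^- n.+1) * qpoch (q ^- n) q k.
Proof.
move=> q0; rewrite qpoch_recl; congr (_ * qpoch _ _ _).
by rewrite exprSr invfM mulfVK.
Qed.

(** At n = 0 both sides vanish, whatever the truncated predecessor is.  This is
    why the recurrences below hold from n = 0 on. *)
Lemma qpoch_pred (K : numFieldType) (q : K) n k : q != 0 ->
  (1 - q ^+ n) * qpoch (q ^- n.-1) q k = - q ^+ n * qpoch (q ^- n) q k.+1.
Proof.
move=> q0; case: n => [|n].
  by rewrite [in RHS]qpoch_eq0 // subrr mul0r mulr0.
rewrite qpoch_succ // mulrA; congr (_ * _).
by rewrite mulrBr mulr1 mulNr mulfV ?expf_neq0 // opprK addrC.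
Qed.

(** The reversal rule.  The hypothesis says b = q^(1-n) / a: then the last k
    factors of (a;q)_n, read backwards, are proportional to the factors of
    (b;q)_k, because 1 - b q^j = - b q^j (1 - a q^(n-1-j)). *)
Lemma qpoch_rev (K : numClosedFieldType) (a b q : K) n k :
  q != 0 -> a * b * q ^+ n = q -> (k <= n)%N ->
  qpoch a q n * (- b) ^+ k * q ^+ 'C(k, 2) = qpoch a q (n - k) * qpoch b q k.
Proof.
move=> q0 ab; elim: k => [|k IH] lkn; first by rewrite subn0 qpoch0 !mulr1.
have := IH (ltnW lkn); rewrite -(subnSK lkn) !qpochS => E.
have -> : 1 - b * q ^+ k = - b * q ^+ k * (1 - a * q ^+ (n - k.+1)).
  have e : a * b * q ^+ k * q ^+ (n - k.+1) = 1.
    apply: (mulIf q0); rewrite mul1r -[RHS]ab -!mulrA -exprSr -exprD.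
    by rewrite -addSnnS subnKC.
  by rewrite -{1}e; ring.
rewrite binS bin1 exprD exprS.
transitivity (qpoch a q n * (- b) ^+ k * q ^+ 'C(k, 2) * (- b * q ^+ k)).
  by ring.
by rewrite E; ring.
Qed.

Lemma qpoch_rev_neq0 (K : numClosedFieldType) (a b q : K) n k :
  q != 0 -> a * b * q ^+ n = q -> (k <= n)%N -> qpoch a q n != 0 ->
  qpoch b q k != 0.
Proof.
move=> q0 ab lkn a0.
have b0 : b != 0 by apply: contra_neq q0 => b0; rewrite -ab b0 mulr0 mul0r.
suff : qpoch a q (n - k) * qpoch b q k != 0.
  by rewrite mulf_eq0 negb_or => /andP[].
by rewrite -qpoch_rev // !mulf_neq0 ?expf_neq0 // oppr_eq0.
Qed.

Lemma qpoch_subn (K : numClosedFieldType) (a b q : K) n k :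
  q != 0 -> a * b * q ^+ n = q -> (k <= n)%N -> qpoch b q k != 0 ->
  qpoch a q (n - k) = qpoch a q n * (- b) ^+ k * q ^+ 'C(k, 2) / qpoch b q k.
Proof. by move=> q0 ab lkn b0; rewrite (qpoch_rev q0 ab) // mulfK. Qed.

(** * Terminating series *)

(** A terminating series may be summed up to any bound beyond n, even if some
    other numerator parameter stops it earlier, since the later terms vanish.
    Series with different n can thus be compared over a common range. *)
Lemma qhyp_sum (K : numFieldType) (aa bb : seq K) (q z : K) n N :
  q != 0 -> q ^- n \in aa -> (n < N)%N ->
  qhyp aa bb q z = \sum_(k < N) qhyp_term aa bb q z k.
Proof.
move=> q0 tn nN; rewrite /qhyp; case: pselect => [ex_n|]; last first.
  by case; exists n.
case: ex_minnP => m tm /(_ n tn) mn.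
have mN : (m.+1 <= N)%N by exact: leq_ltn_trans mn nN.
rewrite -(big_mkord xpredT) (big_cat_nat _ mN) //=.
rewrite [X in _ + X]big_nat_cond [X in _ + X]big1 ?addr0 // => k.
rewrite andbT => /andP[mk _].
suff -> : qhyp_term aa bb q z k = 0 by [].
rewrite /qhyp_term [qpochs aa q k](_ : _ = 0) ?mul0r //.
apply/eqP; rewrite prodf_seq_eq0; apply/hasP.
by exists (q ^- m); rewrite //= qpoch_eq0.
Qed.

(** * The recurrence of the Hermite polynomials *)

(** The two hypotheses at n = 0 read u_1 = (a - b_0) u_0 and
    v_1 = (a - b_0) v_0, hence a single initial value. *)
Lemma rec2_uniq (K : pzRingType) (a : K) (b u v : nat -> K) : u 0%N = v 0%N ->
  (forall n, u n.+1 = a * u n - b n * u n.-1) ->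
  (forall n, v n.+1 = a * v n - b n * v n.-1) -> u =1 v.
Proof.
move=> e0 hu hv n; suff [] : u n = v n /\ u n.-1 = v n.-1 by [].
by elim: n => [//|n [e1 e2]]; split; rewrite //= hu hv e1 e2.
Qed.

Lemma qHermite_termE (K : numFieldType) (q y : K) n k :
  qhyp_term [:: q ^- n; 0] [::] q y k =
  qpoch (q ^- n) q k / qpoch q q k / ((-1) ^+ k * q ^+ 'C(k, 2)) * y ^+ k.
Proof.
rewrite /qhyp_term /qpochs !big_cons !big_nil /= !mulr1 qpoch_base0 mulr1.
by rewrite (_ : 1%:Z - 2%:Z = -1) // exprN1.
Qed.

(** The recurrence of H_n, term by term: multiplication by 1/z^2 raises the
    summation index by one.  All terms are multiples of E n k by
    rational functions of q^n, q^k and z. *)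
Lemma qHermite_term_rec (K : numClosedFieldType) (q z : K) n k :
  0 < `|q| < 1 -> z != 0 ->
  let E m := qhyp_term [:: q ^- m; 0] [::] q (q ^+ m / z ^+ 2) in
  E n.+1 k.+1 = E n k.+1 + z ^- 2 * (E n k - (1 - q ^+ n) * E n.-1 k).
Proof.
move=> hq z0 /=; have q0 : q != 0 by case/andP: hq; rewrite normr_gt0.
rewrite !qHermite_termE.
have -> : (1 - q ^+ n) * (qpoch (q ^- n.-1) q k / qpoch q q k
      / ((-1) ^+ k * q ^+ 'C(k, 2)) * (q ^+ n.-1 / z ^+ 2) ^+ k)
    = - q ^+ n * qpoch (q ^- n) q k.+1 / qpoch q q k
      / ((-1) ^+ k * q ^+ 'C(k, 2)) * ((q ^+ n / z ^+ 2) ^+ k / q ^+ k).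
  rewrite -qpoch_pred //; case: n => [|n]; first by rewrite subrr !mul0r.
  rewrite /= -expr_div_n (_ : q ^+ n.+1 / z ^+ 2 / q = q ^+ n / z ^+ 2).
    by rewrite !mulrA.
  by rewrite exprS; field; rewrite q0 z0.
rewrite (_ : q ^+ n.+1 / z ^+ 2 = q * (q ^+ n / z ^+ 2)); last first.
  by rewrite exprS mulrA.
rewrite qpoch_succ // !qpochS binS bin1 exprD [(q * _) ^+ k.+1]exprMn.
have := qpoch_neq0 k.+1 hq; rewrite qpochS mulf_eq0 negb_or => /andP[b0 c0].
rewrite !(exprS (q ^+ n / _)) !(exprS q) (exprS (-1)).
have := expf_neq0 'C(k, 2) q0; have := expf_neq0 n q0; have := expf_neq0 k q0.
have s0 : (-1) ^+ k != 0 :> K by rewrite expf_neq0 // oppr_eq0 oner_eq0.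
set Y := (q ^+ n / z ^+ 2) ^+ k.
move: s0 c0 b0.
set A := q ^+ k; set B := q ^+ n; set C := q ^+ 'C(k,2); set D := (-1) ^+ k.
set F := qpoch q q k; set G := qpoch _ _ _.
move=> D0 c0 F0 A0 B0 C0.
by field; rewrite A0 B0 C0 D0 F0 c0 q0 z0.
Qed.

Lemma qHermite_rep_rec (K : numClosedFieldType) (q z : K) n :
  0 < `|q| < 1 -> z != 0 ->
  qHermite_rep n.+1 q z =
  (z + z^-1) * qHermite_rep n q z - (1 - q ^+ n) * qHermite_rep n.-1 q z.
Proof.
move=> hq z0; have q0 : q != 0 by case/andP: hq; rewrite normr_gt0.
rewrite /qHermite_rep.
have S m N : (m < N)%N -> qhyp [:: q ^- m; 0] [::] q (q ^+ m / z ^+ 2) =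
    \sum_(k < N) qhyp_term [:: q ^- m; 0] [::] q (q ^+ m / z ^+ 2) k.
  by move=> mN; apply: qhyp_sum mN; rewrite ?mem_head.
have H : qhyp [:: q ^- n.+1; 0] [::] q (q ^+ n.+1 / z ^+ 2) =
    qhyp [:: q ^- n; 0] [::] q (q ^+ n / z ^+ 2) + z ^- 2 *
    (qhyp [:: q ^- n; 0] [::] q (q ^+ n / z ^+ 2) -
     (1 - q ^+ n) * qhyp [:: q ^- n.-1; 0] [::] q (q ^+ n.-1 / z ^+ 2)).
  rewrite (S n.+1 n.+2) // [X in X + _](S n n.+2) // (S n n.+1) //.
  rewrite (S n.-1 n.+1) ?ltnS ?leq_pred // !(big_ord_recl n.+1) -addrA.
  congr (_ + _).
    by rewrite !qHermite_termE !qpoch0 !expr0.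
  rewrite [X in _ - X]mulr_sumr -sumrB mulr_sumr -big_split /=.
  by apply: eq_bigr => k _; rewrite qHermite_term_rec.
rewrite H; case: n {S H} => [|n]; rewrite ?subrr /= !exprS ?expr0.
  by field.
by field.
Qed.

(** * The recurrence of the 3phi2 *)

(** Solved for z + 1/z, this is (1 - w p^k z)(1 - w p^k / z)
    = 1 - w p^k (z + 1/z) + p^(2k+1) with p = w^2. *)
Lemma qpochs_mul_recr (K : numClosedFieldType) (w z : K) k : w != 0 -> z != 0 ->
  let phi k := qpochs [:: w * z; w * z^-1] (w ^+ 2) k in
  w * (z + z^-1) * phi k =
  ((1 + (w ^+ 2) ^+ (2 * k).+1) * phi k - phi k.+1) / (w ^+ 2) ^+ k.
Proof.
move=> w0 z0 /=; rewrite /qpochs !big_cons !big_nil !mulr1 !qpochS.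
rewrite (exprS _ (2 * k)) (mulnC 2 k) exprM.
have := expf_neq0 k (expf_neq0 2 w0).
set A := (w ^+ 2) ^+ k => A0.
by field; rewrite A0 z0.
Qed.

Definition phi32 (K : numFieldType) (w z : K) n : K :=
  qhyp [:: w ^- (2 * n); w * z; w * z^-1] [:: - w ^+ 2; 0] (w ^+ 2) (w ^+ 2).

Lemma phi32_termE (K : numFieldType) (w z : K) n k (p := w ^+ 2) :
  qhyp_term [:: p ^- n; w * z; w * z^-1] [:: - p; 0] p p k =
  qpoch (p ^- n) p k * qpochs [:: w * z; w * z^-1] p k
    / (qpoch p p k * qpoch (- p) p k) * p ^+ k.
Proof.
by rewrite /qhyp_term /qpochs !big_cons !big_nil /= !mulr1 qpoch_base0 mulr1.
Qed.

Lemma phi32E (K : numFieldType) (w z : K) n N (p := w ^+ 2) :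
  w != 0 -> (n < N)%N ->
  phi32 w z n = \sum_(k < N)
    qpoch (p ^- n) p k / (qpoch p p k * qpoch (- p) p k)
    * qpochs [:: w * z; w * z^-1] p k * p ^+ k.
Proof.
move=> w0 nN; have p0 : p != 0 by rewrite expf_neq0.
rewrite /phi32 (exprM w 2 n) (qhyp_sum _ _ p0 (mem_head _ _) nN).
by apply: eq_bigr => k _; rewrite phi32_termE; congr (_ * _); rewrite mulrAC.
Qed.

(** The termwise difference of the two sides telescopes: replacing (z + 1/z)
    phi_k by its value brings in phi_(k+1), and moving this contribution to the
    index k + 1 leaves coefficients of phi_k that cancel. *)
Lemma phi32_contiguous (K : numClosedFieldType) (w z : K) n (p := w ^+ 2) :
  0 < `|w| < 1 -> z != 0 ->
  (1 + p ^+ n.+1) * phi32 w z n.+1 =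
  w * (z + z^-1) * phi32 w z n - p * ((1 - p ^+ n) * phi32 w z n.-1).
Proof.
move=> hw z0; have w0 : w != 0 by case/andP: hw; rewrite normr_gt0.
have p0 : p != 0 by rewrite expf_neq0.
have p1 : `|p| < 1 by rewrite normrX exprn_ilt1 //; case/andP: hw.
have pp : 0 < `|p| < 1 by rewrite p1 normr_gt0 p0.
set phi := qpochs [:: w * z; w * z^-1] p.
pose c n k := qpoch (p ^- n) p k / (qpoch p p k * qpoch (- p) p k).
pose d k := qpoch (p ^- n) p k.+1 / (qpoch p p k * qpoch (- p) p k).
have -> : (1 - p ^+ n) * phi32 w z n.-1 =
    - p ^+ n * \sum_(k < n.+2) d k * phi k * p ^+ k.
  rewrite (@phi32E _ _ _ _ n.+2) // ?ltnS ?(leq_trans (leq_pred n)) //.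
  by rewrite !mulr_sumr; apply: eq_bigr => k _; rewrite /d !mulrA -qpoch_pred.
rewrite (mulrA p) mulrN -exprS mulNr opprK.
rewrite !(@phi32E _ _ _ _ n.+2) // -/p -/phi.
(* The difference of the summands of index k is G k.+1 - G k; its two
   boundary values G 0 and G n.+2 vanish. *)
pose G k := if k is k'.+1 then c n k' * phi k else 0.
apply/eqP; rewrite -subr_eq0 opprD addrA !mulr_sumr -!sumrB; apply/eqP.
transitivity (\sum_(k < n.+2) (G k.+1 - G k)); last first.
  rewrite -(big_mkord xpredT (fun k => G k.+1 - G k)) telescope_sumr //= subr0.
  by rewrite /c qpoch_eq0 // !mul0r.
apply: eq_bigr => -[k /= _] _; rewrite -!/(c _ _).
have -> : w * (z + z^-1) * (c n k * phi k * p ^+ k) =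
    c n k * ((1 + p ^+ (2 * k).+1) * phi k - phi k.+1).
  transitivity (c n k * p ^+ k * (w * (z + z^-1) * phi k)); first by ring.
  by rewrite qpochs_mul_recr // -/p -/phi; field; rewrite expf_neq0.
rewrite /d; case: k => [|k] /=.
  rewrite /c !qpochS !qpoch0 muln0 !expr0 expr1 exprS.
  by field; rewrite expf_neq0.
have -> : (2 * k.+1).+1 = (2 * k).+3 by rewrite mulnS.
rewrite /c qpoch_succ // !qpochS.
have := qpoch_neq0 k.+1 pp.
have : qpoch (- p) p k.+1 != 0 by rewrite qpoch_small_neq0 ?normrN.
rewrite !qpochS !mulf_eq0 !negb_or => /andP[a0 b0] /andP[c0 d0].
have := expf_neq0 n p0; rewrite (mulnC 2 k) !(exprS p) exprM => B0.
by field; rewrite a0 b0 c0 d0 B0 p0.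
Qed.

(** The factor (-p;p)_n absorbs 1 + p^(n+1) and completes 1 - p^n to 1 - q^n,
    where q = p^2. *)
Lemma phi32_recurrence (K : numClosedFieldType) (w z : K) n :
  0 < `|w| < 1 -> z != 0 ->
  let u n := w ^- n * qpoch (- w ^+ 2) (w ^+ 2) n * phi32 w z n in
  u n.+1 = (z + z^-1) * u n - (1 - (w ^+ 4) ^+ n) * u n.-1.
Proof.
move=> hw z0 /=; have w0 : w != 0 by case/andP: hw; rewrite normr_gt0.
have C := @phi32_contiguous _ w z n hw z0; rewrite /= in C.
have -> : w ^+ 4 = w ^+ 2 * w ^+ 2 by rewrite -exprD.
rewrite exprMn [in LHS]qpochS.
transitivity (w ^- n.+1 * qpoch (- w ^+ 2) (w ^+ 2) n *
    ((1 + (w ^+ 2) ^+ n.+1) * phi32 w z n.+1)).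
  by rewrite (exprS (w ^+ 2)); ring.
rewrite {}C; case: n => [|n].
  by rewrite !expr0 expr1; field; rewrite w0 z0.
rewrite [n.+1.-1]/= qpochS !(exprS w n.+1) !(exprS w n) !(exprS (w ^+ 2) n).
by field; rewrite expf_neq0 // w0 z0.
Qed.

Lemma qHermite_phi32 (K : numClosedFieldType) (w z : K) n :
  0 < `|w| < 1 -> z != 0 ->
  qHermite_rep n (w ^+ 4) z =
  w ^- n * qpoch (- w ^+ 2) (w ^+ 2) n * phi32 w z n.
Proof.
move=> hw z0; move: n.
have w0 : w != 0 by case/andP: hw; rewrite normr_gt0.
have hq : 0 < `|w ^+ 4| < 1.
  case/andP: hw => _ w1.
  by rewrite normr_gt0 expf_neq0 //= normrX exprn_ilt1 ?normr_ge0.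
apply: (@rec2_uniq _ (z + z^-1) (fun n => 1 - (w ^+ 4) ^+ n)) => [|n|n].
- rewrite /qHermite_rep /phi32 (exprM w 2 0) !(@qhyp_sum _ _ _ _ _ 0 1) //;
    rewrite ?mem_head ?expf_neq0 //.
  rewrite !big_ord1 qHermite_termE phi32_termE /qpochs /= !big_cons !big_nil.
  by rewrite !qpoch0 bin0n !expr0 !invr1 !mulr1.
- exact: qHermite_rep_rec.
- exact: phi32_recurrence.
Qed.

(** * Summation backwards *)

Lemma double_bin2 n : (n + 2 * 'C(n, 2) = n ^ 2)%N.
Proof. by elim: n => // n; rewrite binS bin1 -!mulnn; lia. Qed.

(** In the 3phi2 the numerator parameters p^-n, wz, w/z and the denominator
    parameters p, -p are paired by reversal with p, p^(1-n)/(wz), p^(1-n) z/w,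
    p^-n and -p^-n.  Numerator factors become denominator factors and
    conversely, which gives the parameters of the 2phi2. *)
Lemma phi32_reverse (K : numClosedFieldType) (w z : K) n :
  0 < `|w| < 1 -> z != 0 ->
  qpochs [:: w * z; w * z^-1] (w ^+ 2) n != 0 ->
  w ^- n * qpoch (- w ^+ 2) (w ^+ 2) n * phi32 w z n =
  (-1) ^+ n * w ^- (n ^ 2) * qpochs [:: w * z; w * z^-1] (w ^+ 2) n *
     qhyp [:: w ^- (2 * n); - w ^- (2 * n)]
          [:: w ^ (1 - (2 * n)%:Z) * z; w ^ (1 - (2 * n)%:Z) * z^-1]
          (w ^+ 2) (- w ^+ 2).
Proof.
move=> hw z0 nz.
have w0 : w != 0 by case/andP: hw; rewrite normr_gt0.
have p0 : w ^+ 2 != 0 by rewrite expf_neq0.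
rewrite /phi32 (exprM w 2 n).
have S := qhyp_sum _ _ p0 (mem_head _ _) (ltnSn n); rewrite !S {S}.
rewrite !mulr_sumr (reindex_inj rev_ord_inj) /=.
apply: eq_bigr => -[k /= lkn] _; rewrite ltnS in lkn; rewrite subSS.
rewrite phi32_termE.
have -> : w ^ (1 - (2 * n)%:Z) = w * (w ^+ 2) ^- n.
  by rewrite expfzDr // expr1z -exprnN exprM.
set p := w ^+ 2 in p0 *.
have p1 : `|p| < 1.
  by rewrite normrX exprn_ilt1 // ?normr_ge0; case/andP: hw.
have pp : 0 < `|p| < 1 by rewrite p1 normr_gt0 p0.
have np1 : `|- p| < 1 by rewrite normrN.
have pn0 := expf_neq0 n p0.
move: nz; rewrite /qhyp_term /qpochs !big_cons !big_nil /= !mulr1.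
rewrite mulf_eq0 negb_or => /andP[nz1 nz2].
have e1 : w * z * (w * p ^- n * z^-1) * p ^+ n = p.
  by rewrite /p in pn0 *; field; rewrite pn0 z0.
have e2 : w * z^-1 * (w * p ^- n * z) * p ^+ n = p.
  by rewrite /p in pn0 *; field; rewrite pn0 z0.
have e3 : - p * - p ^- n * p ^+ n = p by field.
have e4 : p ^- n * p * p ^+ n = p by field.
have e5 : p * p ^- n * p ^+ n = p by field.
have Dn0 := qpoch_neq0 n pp; have Dk0 := qpoch_neq0 k pp.
have C0 := expf_neq0 'C(k, 2) p0.
have M0 : qpoch (- p) p n != 0 by exact: qpoch_small_neq0.
have B10 := qpoch_rev_neq0 p0 e1 lkn nz1.
have B20 := qpoch_rev_neq0 p0 e2 lkn nz2.
have B30 := qpoch_rev_neq0 p0 e3 lkn M0.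
have E0 := qpoch_rev_neq0 p0 e5 lkn Dn0.
(* The constant (p^-n;p)_n / (p;p)_n is the reversal of (p;p)_n at k = n. *)
have := qpoch_rev p0 e5 (leqnn n); rewrite subnn qpoch0 mul1r => En.
rewrite (qpoch_subn p0 e1 lkn B10) (qpoch_subn p0 e2 lkn B20).
rewrite (qpoch_subn p0 e3 lkn B30) (qpoch_subn p0 e4 lkn Dk0).
rewrite (qpoch_subn p0 e5 lkn E0) -En.
have expo : p ^+ n * p ^+ 'C(n, 2) * w ^+ (n ^ 2) = w ^+ n * (p ^+ n) ^+ n.
  rewrite /p -!exprM -!exprD; congr (_ ^+ _).
  by rewrite -mulnA mulnn -double_bin2; ring.
have -> : p ^+ 'C(n, 2) = w ^+ n * (p ^+ n) ^+ n / (p ^+ n * w ^+ (n ^ 2)).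
  by rewrite -expo; field; rewrite expf_neq0 ?pn0.
have -> : p ^+ (n - k) = p ^+ n / p ^+ k.
  by rewrite -[in RHS](subnK lkn) exprD mulfK ?expf_neq0.
rewrite (_ : 3%:Z - 2%:Z = 1) // expr1z opprK -/p.
set s := (-1) ^+ k.
have sE b : (- b) ^+ k = s * b ^+ k by rewrite exprNn.
(* The factors of wz and w/z contribute w^k each, where p^k occurs opposite. *)
have pk : p ^+ k = w ^+ k * w ^+ k by rewrite -exprMn -expr2.
(* From here on p is an atom, related to w through pk alone. *)
clearbody p.
rewrite !sE [(- p ^- n) ^+ n]exprNn !exprMn !exprVn !pk.
have s0 : s != 0 by rewrite expf_neq0 // oppr_eq0 oner_eq0.
have := expf_neq0 n pn0; have := expf_neq0 k pn0; have := expf_neq0 n w0.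
have := expf_neq0 (n ^ 2) w0; have := expf_neq0 k w0; have := expf_neq0 k z0.
move: (w ^+ k) (z ^+ k) (w ^+ (n ^ 2)) (w ^+ n) ((p ^+ n) ^+ k) ((p ^+ n) ^+ n).
move=> Wk Zk Wnn Wn Pnk Pnn Zk0 Wk0 Wnn0 Wn0 Pnk0 Pnn0.
by field; rewrite Zk0 Wk0 Wnn0 Wn0 Pnk0 Pnn0 s0 C0 Dn0 Dk0 M0 B10 B20 B30 E0
  pn0.
Qed.

Unset Implicit Arguments.

(* w is the fixed fourth root of q: q^(j/4) is w to the power j. *)
Theorem theorem3p27 (R : realType) (n : nat) (q z x w : R[i])
    (hq : 0 < `|q| < 1) (hz : z != 0) (hx : x = (z + z^-1) / 2)
    (hx0 : x != 0) (hw : w ^+ 4 = q) :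
  cqHermite n q x =
    w ^- n * qpoch (- w ^+ 2) (w ^+ 2) n *
    qhyp [:: w ^- (2 * n); w * z; w * z^-1] [:: - w ^+ 2; 0]
         (w ^+ 2) (w ^+ 2)
  /\
  (qpochs [:: w * z; w * z^-1] (w ^+ 2) n != 0 ->
   cqHermite n q x =
     (-1) ^+ n * w ^- (n ^ 2) * qpochs [:: w * z; w * z^-1] (w ^+ 2) n *
     qhyp [:: w ^- (2 * n); - w ^- (2 * n)]
          [:: w ^ (1 - (2 * n)%:Z) * z; w ^ (1 - (2 * n)%:Z) * z^-1]
          (w ^+ 2) (- w ^+ 2)).
Proof.
have hw' : 0 < `|w| < 1.
  move: hq; rewrite -hw normrX expr_lt1 // => /andP[w0 ->].
  rewrite normr_gt0 andbT.
  by apply: contraTneq w0 => ->; rewrite normr0 expr0n ltxx.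
rewrite hx cqHermiteE // -hw; split; first exact: qHermite_phi32.
by move=> nz; rewrite qHermite_phi32 // phi32_reverse.
Qed.
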